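(* Let $B\in\mathfrak B$ be a basic block and $k\ge1$. Define ribbons $D_0=B$ and, for $1\le i\le k$, either $D_i=D_{i-1}\odot D_{i-1}^t$ or $D_i=D_{i-1}\cdot D_{i-1}^t$ (the choice may vary with $i$). Then $\mathfrak r_{D_k}$ is $p$-positive.
   Context: Boxes $(r,c)$ are indexed by row $r$ (top to bottom) and column $c$. A connected ribbon of composition $\alpha=(\alpha_1,\dots,\alpha_\ell)$ has $\alpha_r$ consecutive boxes in row $r$, with the leftmost box of row $r$ directly above the rightmost box of row $r+1$. For ribbons $\alpha=(\alpha_1,\dots,\alpha_k)$ and $\beta=(\beta_1,\dots,\beta_\ell)$, the concatenation is $\alpha\cdot\beta=(\alpha_1,\dots,\alpha_k,\beta_1,\dots,\beta_\ell)$ and the near concatenation is $\alpha\odot\beta=(\alpha_1,\dots,\alpha_{k-1},\alpha_k+\beta_1,\beta_2,\dots,\beta_\ell)$. $D^t$ is the transpose of $D$ (reflection in the main diagonal) and $D^\circ$ its antipodal rotation (rotation by 180 degrees). For a ribbon $D$, $\mathfrak r_D=\sum_T x^{c(T)}$ over fillings $T$ of $D$ with letters of $\{1'<1<2'<2<\cdots\}$ having rows and columns weakly increasing, at most one unmarked $k$ per column and at most one marked $k'$ per row; $c(T)_i$ counts entries $i$ or $i'$. $\triangle_{n,k}$ is the ribbon of composition $(1^{k-1},n-k+1)$. The set of basic blocks of size $n$ is $\mathfrak B_n=\{\triangle_{n,1},\triangle_{n,1}^t,\triangle_{n,3},\triangle_{n,3}^t,\triangle_{n,3}^\circ,(\triangle_{n,3}^t)^\circ\}$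 (only the first two when $n\le 2$), and $\mathfrak B=\bigcup_{n\ge1}\mathfrak B_n$. A symmetric function is $p$-positive if all its coefficients in the power sum basis are nonnegative. *)

(* Defs.v *)
From mathcomp Require Import all_boot all_order all_algebra.
Set Implicit Arguments. Unset Strict Implicit. Unset Printing Implicit Defensive.
Import Order.TTheory GRing.Theory Num.Theory.

Definition composition (al : seq nat) : bool := all (fun x => 0 < x) al.

(* starting (leftmost) column of row r (rows indexed from 0, top to bottom);
   the bottom row starts in column 0, and the leftmost box of row r is
   directly above the rightmost box of row r+1. *)
Definition start (al : seq nat) (r : nat) : nat :=
  \sum_(r.+1 <= j < size al) (nth 0 al j).-1.

Definition boxes (al : seq nat) : seq (nat * nat) :=
  flatten [seq [seq (r, c) | c <- iota (start al r) (nth 0 al r)]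
          | r <- iota 0 (size al)].

Definition boxesZ (al : seq nat) : seq (int * int) :=
  [seq (Posz b.1, Posz b.2) | b <- boxes al].

Definition is_transpose (al be : seq nat) : Prop :=
  exists d : int * int,
    boxesZ be =i [seq (b.2 + d.1, b.1 + d.2)%R | b <- boxesZ al].

Definition is_rot (al be : seq nat) : Prop :=
  exists d : int * int,
    boxesZ be =i [seq (d.1 - b.1, d.2 - b.2)%R | b <- boxesZ al].

Definition near_cat (al be : seq nat) : seq nat :=
  take (size al).-1 al ++ (last 0 al + head 0 be) :: behead be.

Definition tri (n k : nat) : seq nat := nseq k.-1 1 ++ [:: n - k + 1].

Definition basic_block (n : nat) (B : seq nat) : Prop :=
  composition B /\
  (B = tri n 1 \/ is_transpose (tri n 1) B \/
   (2 < n /\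
    (B = tri n 3 \/ is_transpose (tri n 3) B \/ is_rot (tri n 3) B \/
     exists T, composition T /\ is_transpose (tri n 3) T /\ is_rot T B))).

(* Letters of {1'<1<2'<2<...<N'<N} are encoded by v : 'I_(2N):
   v = 2i  is the marked letter (i+1)',  v = 2i+1 is the unmarked letter i+1.
   So the order on letters is the order on v, v is unmarked iff odd v,
   and the variable index (0-based) of v is v./2. *)
Definition valid_filling (bs : seq (nat * nat)) (N : nat)
  (T : {ffun 'I_(size bs) -> 'I_(2 * N)}) : bool :=
  [forall j : 'I_(size bs), forall j' : 'I_(size bs),
    let b := nth (0, 0) bs j in let b' := nth (0, 0) bs j' in
    [&& ((b.1 == b'.1) && (b.2 < b'.2)) ==> (T j <= T j'),
        ((b.2 == b'.2) && (b.1 < b'.1)) ==> (T j <= T j'),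
        [&& j != j', b.2 == b'.2 & T j == T j'] ==> ~~ odd (T j)
      & [&& j != j', b.1 == b'.1 & T j == T j'] ==> odd (T j)
          (* at most one marked k' per row *) ]].

(* coefficient of x^a (a : exponent vector in N variables) in r_D(x_1,...,x_N) *)
Definition rcoef (D : seq nat) (N : nat) (a : 'I_N -> nat) : nat :=
  #|[set T : {ffun 'I_(size (boxes D)) -> 'I_(2 * N)} |
      valid_filling T &&
      [forall i : 'I_N, #|[set j | (T j : nat)./2 == i]| == a i]]|.
Arguments rcoef D N a : clear implicits.

(* coefficient of x^a in p_lam(x_1,...,x_N) = prod_j (x_1^{lam_j}+...+x_N^{lam_j}) *)
Definition pcoef (lam : seq nat) (N : nat) (a : 'I_N -> nat) : nat :=
  #|[set g : {ffun 'I_(size lam) -> 'I_N} |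
      [forall i : 'I_N, \sum_(j | g j == i) nth 0 lam j == a i]]|.
Arguments pcoef lam N a : clear implicits.

Definition mparts (n : nat) (m : {ffun 'I_n -> 'I_n.+1}) : seq nat :=
  flatten [seq nseq (m i) i.+1 | i <- enum 'I_n].

(* A homogeneous symmetric function of degree n, given by its coefficients
   F N a (coefficient of x^a in its restriction to N variables, for all N),
   is p-positive: it is a nonnegative combination of the p_lam, |lam| = n. *)
Definition p_positive (n : nat) (F : forall N : nat, ('I_N -> nat) -> rat) : Prop :=
  exists c : {ffun 'I_n -> 'I_n.+1} -> rat,
    (forall m, 0 <= c m)%R /\
    forall (N : nat) (a : 'I_N -> nat),
      F N a = (\sum_(m : {ffun 'I_n -> 'I_n.+1} | sumn (mparts m) == n)
                 c m * (pcoef (mparts m) N a)%:R)%R.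

(* Main.v *)
(* Read a filled ribbon from its bottom left box to its top right box.  With
   v ~> v' meaning "v < v', or v = v' is unmarked", a step to the right imposes
   v ~> v' on consecutive letters and a step up imposes its negation.  Hence
   r_a r_b = r_{a.b} + r_{a(.)b}, and a function on ribbons obeying this rule is
   determined by its values on rows.  Newton's identity
   n q_n = 2 sum_{k odd} p_k q_{n-k} shows that rows and columns of the same size
   have the same value q_n, so r_D is invariant under transposition and rotation.
   As (D (.) D^t)^t = D . D^t, both concatenations of D with D^t have the value
   r_D^2 / 2, and p-positivity passes from D_{i-1} to D_i.  For the blocks, q_n is
   p-positive by Newton's identity, and r_{(1,1,n-2)} = q_n - q_1 q_{n-1} + q_2 q_{n-2}
   obeys a similar recurrence with nonnegative terms. *)
Require Import Defs.
From mathcomp Require Import all_boot all_order all_algebra.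
From mathcomp Require Import mpoly ring zify.
Set Implicit Arguments.
Unset Strict Implicit.
Unset Printing Implicit Defensive.
Import Order.TTheory GRing.Theory Num.Theory.

(** * Words with a prescribed pattern *)

Section Words.
Local Open Scope ring_scope.
Variables (A : comNzRingType) (L : finType) (x : L -> A) (R : rel L).

Fixpoint word_sum_from (p : seq bool) (y : L) : A :=
  if p is b :: p' then x y * \sum_(z | R y z == b) word_sum_from p' z else x y.

Definition word_sum (p : seq bool) : A := \sum_y word_sum_from p y.

(** The last letter of the first word and the first letter of the second are either related by [R]
    or not, which gives the two summands; induction on [p] leads to this junction. *)
Lemma word_sum_fromM p q y :
  word_sum_from p y * word_sum q =
  word_sum_from (p ++ true :: q) y + word_sum_from (p ++ false :: q) y.
Proof.
elim: p y => [|b p IHp] y /=.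
  rewrite /word_sum (bigID (R y)) /= mulrDr.
  by congr (_ * _ + _ * _); apply: eq_bigl => z; case: (R y z).
rewrite -mulrA -mulrDr -big_split /= mulr_suml; congr (_ * _).
by apply: eq_bigr => z _; apply: IHp.
Qed.

Lemma word_sumM p q :
  word_sum p * word_sum q =
  word_sum (p ++ true :: q) + word_sum (p ++ false :: q).
Proof.
rewrite /word_sum mulr_suml -big_split /=.
by apply: eq_bigr => y _; apply: word_sum_fromM.
Qed.

(** Passes from the recursion to functions on positions, the form in which fillings are counted. *)
Lemma word_sum_ffun p :
  word_sum p = \sum_(T : {ffun 'I_(size p).+1 -> L} |
      [forall i : 'I_(size p), R (T (inord i)) (T (inord i.+1)) == nth true p i])
    \prod_j x (T j).
Proof.
pose good p (T : {ffun 'I_(size p).+1 -> L}) :=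
  [forall i : 'I_(size p), R (T (inord i)) (T (inord i.+1)) == nth true p i].
suff word_sum_fromE y : word_sum_from p y =
    \sum_(T : {ffun 'I_(size p).+1 -> L} | good p T && (T ord0 == y)) \prod_j x (T j).
  rewrite /word_sum (eq_bigr _ (fun y _ => word_sum_fromE y)).
  by rewrite [RHS](partition_big (fun T : {ffun _ -> _} => T ord0) predT).
elim: p y => [|b p IHp] y /=.
  rewrite (big_pred1 [ffun=> y]) => [|T] /=; first by rewrite big_ord1 ffunE.
  rewrite andb_idl; last by move=> _; apply/forallP => -[].
  apply/eqP/eqP => [<-|->]; last by rewrite ffunE.
  by apply/ffunP => j; rewrite ffunE (ord1 j).
(* Words beginning with [y] correspond to their tails, so the sum is reindexed by words one letter
   shorter. *)
pose cons_f (f : {ffun 'I_(size p).+1 -> L}) : {ffun 'I_(size p).+2 -> L} :=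
  [ffun i => oapp f y (unlift ord0 i)].
pose tail_f (f : {ffun 'I_(size p).+2 -> L}) : {ffun 'I_(size p).+1 -> L} :=
  [ffun i => f (lift ord0 i)].
have cons0 f : cons_f f ord0 = y by rewrite /cons_f ffunE unlift_none.
have consS f j : cons_f f (lift ord0 j) = f j by rewrite /cons_f ffunE liftK.
rewrite (reindex_onto cons_f tail_f) /=; last first.
  move=> f /andP[_ /eqP f0]; apply/ffunP => i; rewrite /cons_f ffunE.
  by case: unliftP => [j ->|->] //=; rewrite ffunE.
have lift_inord k : (k < (size p).+1)%N ->
    inord k.+1 = lift ord0 (inord k : 'I_(size p).+1) :> 'I_(size p).+2.
  by move=> lt_k; apply: val_inj; rewrite /= !inordK.
have inord00 n : inord 0 = ord0 :> 'I_n.+1 by apply: val_inj; rewrite /= inordK.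
rewrite (eq_bigl (fun f : {ffun 'I_(size p).+1 -> L} => (R y (f ord0) == b) && good p f)) => [|f]; last first.
  have -> : tail_f (cons_f f) = f by apply/ffunP => i; rewrite ffunE consS.
  rewrite cons0 !eqxx !andbT.
  apply/forallP/andP => [goodT | [Rb /forallP goodf] i].
    split; first by have := goodT ord0; rewrite /= inord00 cons0 lift_inord // consS inord00.
    apply/forallP => -[i lt_i].
    have := goodT (@Ordinal (size p).+1 i.+1 lt_i).
    by rewrite /= !lift_inord ?consS // ltnW.
  case: i => -[|i] lt_i.
    by rewrite /= inord00 cons0 lift_inord // consS inord00.
  rewrite /= !lift_inord ?consS //; last exact: ltnW.
  exact: (goodf (@Ordinal (size p) i lt_i)).
rewrite (eq_bigr (fun f : {ffun 'I_(size p).+1 -> L} => x y * \prod_j x (f j))) => [|f _]; last first.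
  rewrite big_ord_recl cons0; congr (_ * _).
  by apply: eq_bigr => j _; rewrite consS.
rewrite -mulr_sumr; congr (_ * _).
rewrite (eq_bigr _ (fun z _ => IHp z)).
rewrite [RHS](partition_big (fun f : {ffun 'I_(size p).+1 -> L} => f ord0) (fun z => R y z == b)) => [|f /andP[]//].
apply: eq_bigr => z Rz; apply: eq_bigl => f.
by case: (f ord0 =P z) => [->|]; rewrite ?Rz ?andbF.
Qed.
End Words.

(** The rule expresses the value at [p1 ++ false :: p2] through patterns with fewer [false], so
    induction on their number leaves only rows. *)
Lemma word_sum_eq_of_trueseq (A : comNzRingType) (r r' : seq bool -> A) :
  (forall p q, r p * r q = r (p ++ true :: q) + r (p ++ false :: q))%R ->
  (forall p q, r' p * r' q = r' (p ++ true :: q) + r' (p ++ false :: q))%R ->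
  (forall n, r (nseq n true) = r' (nseq n true)) ->
  r =1 r'.
Proof.
move=> rM r'M rr' p.
have [m le_m] := ubnP (count negb p); elim: m p le_m => // m IHm p.
case: (boolP (false \in p)) => [|Np _]; last first.
  have -> : p = nseq (size p) true.
    apply/all_pred1P/allP => b bp; apply: contraNeq Np => /=.
    by case: b bp.
  exact: rr'.
case/splitPr => p1 p2; rewrite count_cat /= => le_m.
have rE (s : seq bool -> A) :
    (forall p q, s p * s q = s (p ++ true :: q) + s (p ++ false :: q))%R ->
    s (p1 ++ false :: p2) = (s p1 * s p2 - s (p1 ++ true :: p2))%R.
  by move->; rewrite addrAC subrr add0r.
rewrite (rE r) // (rE r') //.
congr (_ * _ - _)%R; apply: IHm; rewrite ?count_cat /=; lia.
Qed.

(** * Newton's identity for an alphabet with repeatable and non-repeatable letters *)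

Section Newton.
Local Open Scope ring_scope.
Variables (A : comNzRingType).

(* A letter [(x, b)] of weight [x] may be repeated iff [b]; [chain_sum s n] sums
   over the weakly increasing words of length [n] in the ordered alphabet [s]. *)
Fixpoint chain_sum (s : seq (A * bool)) : nat -> A :=
  if s is (x, b) :: s' then
    fix chain_sum_cons n := if n is n'.+1 then
      chain_sum s' n'.+1 + x * (if b then chain_sum_cons n' else chain_sum s' n')
    else 1
  else fun n => (n == 0)%:R.

(** For k > 0, the coefficient of t^(k-1) in the logarithmic derivative of the product of 1/(1 - x
    t) over repeatable letters and 1 + x t over the others. *)
Definition signed_psum (s : seq (A * bool)) (k : nat) : A :=
  \sum_(l <- s) (if l.2 then l.1 ^+ k else (-1) ^+ k.-1 * l.1 ^+ k).

Lemma chain_sum0 s : chain_sum s 0 = 1.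
Proof. by case: s => [|[x b] s]. Qed.

(** Coefficientwise form of C' = P C, where C(t) is the product above and P its logarithmic
    derivative. A new letter multiplies C by one factor and adds one summand to P. *)
Lemma newton_chain_sum s n :
  (chain_sum s n) *+ n = \sum_(k < n) signed_psum s k.+1 * chain_sum s (n.-1 - k)%N.
Proof.
elim: s n => [|[x b] s IHs] n.
  case: n => [|n]; first by rewrite big_ord0.
  by rewrite mul0rn big1 // => k _; rewrite /signed_psum big_nil mul0r.
set c' := chain_sum (_ :: s); set P := signed_psum s in IHs *.
have PE k : signed_psum ((x, b) :: s) k.+1 =
    (if b then x ^+ k.+1 else (-1) ^+ k * x ^+ k.+1) + P k.+1.
  by rewrite /signed_psum big_cons.
under eq_bigr => k _ do rewrite PE mulrDl.
rewrite big_split /= {PE}.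
case: b @c' => c'.
  have c'S m : c' m.+1 = chain_sum s m.+1 + x * c' m by [].
  have c'0 : c' 0 = 1 by [].
  elim: n => [|n IHn]; first by rewrite !big_ord0 addr0.
  (* Both parts of the sum for [n.+1] are reduced to those for [n]: first the geometric series of
     the new letter, then the part of the old letters. *)
  have B_rec : \sum_(k < n.+1) x ^+ k.+1 * c' (n - k)%N =
      x * c' n + x * \sum_(k < n) x ^+ k.+1 * c' (n.-1 - k)%N.
    rewrite big_ord_recl expr1 subn0 mulr_sumr; congr (_ + _).
    apply: eq_bigr => k _; rewrite lift0 exprS mulrA; congr (_ * c' _); lia.
  have A_rec : \sum_(k < n.+1) P k.+1 * c' (n - k)%N =
      chain_sum s n.+1 *+ n.+1 + x * \sum_(k < n) P k.+1 * c' (n.-1 - k)%N.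
    rewrite IHs !big_ord_recr /= subnn c'0 chain_sum0 addrAC mulr_sumr -big_split /=.
    congr (_ + _); apply: eq_bigr => k _.
    have -> : (n - k = (n.-1 - k).+1)%N by have := ltn_ord k; lia.
    by rewrite c'S; ring.
  rewrite /= B_rec A_rec c'S {A_rec B_rec}.
  move: IHn; set B := \sum_(k < n) x ^+ _ * _; set C := \sum_(k < n) _ => IHn.
  have -> : C = c' n *+ n - B by rewrite IHn; ring.
  ring.
have c'S m : c' m.+1 = chain_sum s m.+1 + x * chain_sum s m by [].
have c'0 : c' 0 = 1 by [].
case: n => [|n]; first by rewrite !big_ord0 addr0.
(* The factor 1 + x t of the new generating function cancels the denominator of x/(1 + x t). *)
have -> : \sum_(k < n.+1) (-1) ^+ k * x ^+ k.+1 * c' (n - k)%N = x * chain_sum s n.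
  elim: n => [|n IHn]; first by rewrite big_ord1 c'0 chain_sum0; ring.
  rewrite big_ord_recl subn0 c'S.
  transitivity (x * chain_sum s n.+1 + x * x * chain_sum s n - x * (x * chain_sum s n)); last by ring.
  rewrite -[in RHS]IHn mulr_sumr -sumrN; congr (_ + _); first by rewrite expr0 expr1; ring.
  apply: eq_bigr => k _; rewrite lift0 subSS !exprS; ring.
have -> : \sum_(k < n.+1) P k.+1 * c' (n - k)%N =
    chain_sum s n.+1 *+ n.+1 + x * (chain_sum s n *+ n).
  rewrite !IHs !big_ord_recr /= subnn c'0 chain_sum0 addrAC mulr_sumr -big_split /=.
  congr (_ + _); apply: eq_bigr => k _.
  have -> : (n - k = (n.-1 - k).+1)%N by have := ltn_ord k; lia.
  by rewrite c'S; ring.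
by rewrite c'S; ring.
Qed.
End Newton.

(** * Ribbon polynomials *)

Section ConstantPattern.
Local Open Scope ring_scope.
Variables (A : comNzRingType) (L : finType) (x : L -> A) (R : rel L).

(** A constant pattern makes the word a chain for [lt]. After [y], the next letter ranges over the
    later letters of [e], and over [y] itself if it is repeatable; hence the induction over suffixes
    of [e]. *)
Lemma word_sum_nseq (v : bool) (lt : rel L) (b : pred L) (e : seq L) n :
  transitive lt -> irreflexive lt -> sorted lt e -> e =i L ->
  (forall y z, (R y z == v) = lt y z || (b y && (y == z))) ->
  word_sum x R (nseq n v) = chain_sum [seq (x y, b y) | y <- e] n.+1.
Proof.
move=> lt_tr lt_irr lt_e eT RE.
have word_sum_suffix s pre : e = pre ++ s ->
    \sum_(y <- s) word_sum_from x R (nseq n v) y =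
    chain_sum [seq (x y, b y) | y <- s] n.+1.
  elim: n s pre => [|n IHn] s; elim: s => [|y s IHs] pre e_eq.
  - by rewrite big_nil.
  - rewrite big_cons (IHs (rcons pre y)) ?cat_rcons //= addrC chain_sum0 if_same.
    by rewrite mulr1.
  - by rewrite big_nil.
  have Ee : e = rcons pre y ++ s by rewrite cat_rcons.
  rewrite big_cons (IHs _ Ee) /= addrC; congr (_ + _ * _).
  have := lt_e; rewrite e_eq sorted_pairwise // pairwise_cat /=.
  case/and3P=> /allrelP lt_pre _ /andP[/allP lt_y lt_s].
  have in_s z : (z \in s) = lt y z.
    apply/idP/idP => [/lt_y // | lt_yz].
    have : z \in e by rewrite eT.
    rewrite e_eq mem_cat inE => /or3P[|/eqP Dz|//].
      move=> /lt_pre /(_ (mem_head y s)) lt_zy.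
      by have := lt_tr _ _ _ lt_yz lt_zy; rewrite lt_irr.
    by rewrite Dz lt_irr in lt_yz.
  have Us : uniq s by apply: (sorted_uniq lt_tr lt_irr); rewrite sorted_pairwise.
  have Uys : uniq (y :: s) by rewrite /= in_s lt_irr.
  case by_eq: (b y).
    have := IHn (y :: s) _ e_eq; rewrite /= by_eq => <-; rewrite (big_uniq _ Uys).
    by apply: eq_bigl => z; rewrite RE by_eq inE in_s eq_sym orbC.
  rewrite -(IHn s _ Ee) (big_uniq _ Us).
  by apply: eq_bigl => z; rewrite RE by_eq in_s orbF.
rewrite /word_sum -(word_sum_suffix e [::]) // [RHS]big_uniq; last exact: (sorted_uniq lt_tr lt_irr lt_e).
by apply: eq_bigl => y; rewrite eT.
Qed.
End ConstantPattern.

Lemma mulrSn_inj (V : lmodType rat) n : injective (fun u : V => u *+ n.+1)%R.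
Proof.
move=> u v /= uv; have n_neq0 : (n.+1%:R != 0 :> rat)%R by rewrite pnatr_eq0.
by apply: (scalerI n_neq0); rewrite !scaler_nat.
Qed.

Lemma half_ord_subproof N (v : 'I_(2 * N)) : v./2 < N.
Proof. by have := ltn_ord v; lia. Qed.

Definition half_ord N (v : 'I_(2 * N)) : 'I_N := Ordinal (half_ord_subproof v).

(* [rises v v'] holds iff [v v'] may stand in consecutive boxes of a row; a box
   holding [v'] may stand directly above one holding [v] iff it fails. *)
Definition rises N (v v' : 'I_(2 * N)) : bool := (v < v') || (odd v && (v == v')).

Definition ribbon_poly N : seq bool -> {mpoly rat[N]} :=
  word_sum (fun v => 'X_(half_ord v))%R (@rises N).

Definition psum N k : {mpoly rat[N]} := (\sum_(i < N) 'X_i ^+ k)%R.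

(* The power sum of degree [k] of the alphabet 1',1,2',2,... in which the primed
   letters count as odd variables: it is 2 p_k or 0. *)
Definition super_psum N k : {mpoly rat[N]} := ((1 + (-1) ^+ k.-1) *: psum N k)%R.

(** This is q_n: a row of n boxes has n - 1 steps, and q_0 = 1 is the initial value in Newton's
    identity. *)
Definition row_poly N n : {mpoly rat[N]} :=
  if n is n'.+1 then ribbon_poly N (nseq n' true) else 1%R.

Section RibbonPoly.
Local Open Scope ring_scope.
Variable N : nat.

Lemma ribbon_polyM p q :
  ribbon_poly N p * ribbon_poly N q =
  ribbon_poly N (p ++ true :: q) + ribbon_poly N (p ++ false :: q).
Proof. exact: word_sumM. Qed.

Lemma sum_half_ord (V : nmodType) (F : bool -> 'I_N -> V) :
  \sum_(v < 2 * N) F (odd v) (half_ord v) = \sum_(i < N) (F true i + F false i).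
Proof.
have lt_h (ib : 'I_N * bool) : (ib.2 + ib.1.*2 < 2 * N)%N.
  by case: ib => i [] /=; have := ltn_ord i; lia.
pose h (ib : 'I_N * bool) : 'I_(2 * N) := Ordinal (lt_h ib).
have h_bij : bijective h.
  exists (fun v => (half_ord v, odd v)) => [[i b]|v].
    rewrite /h /=; congr (_, _); last by rewrite oddD odd_double addbF oddb.
    by apply: val_inj; rewrite /= half_bit_double.
  by apply: val_inj; rewrite /= odd_double_half.
rewrite (reindex h) /=; last exact: onW_bij.
transitivity (\sum_(i < N) \sum_b F b i); last first.
  by apply: eq_bigr => i _; rewrite big_bool.
rewrite pair_bigA /=; apply: eq_bigr => -[i b] _ /=.
rewrite oddD odd_double addbF oddb; congr (F b _).
by apply: val_inj; rewrite /= half_bit_double.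
Qed.

(** Each variable belongs to one marked and one unmarked letter, so it does not matter which of the
    two kinds is the repeatable one. *)
Lemma signed_psum_letters (b : bool) (e : seq 'I_(2 * N)) k :
  perm_eq e (enum 'I_(2 * N)) ->
  signed_psum [seq ('X_(half_ord y) : {mpoly rat[N]}, b == odd y) | y <- e] k =
  super_psum N k.
Proof.
move=> e_perm; rewrite /signed_psum big_map (perm_big _ e_perm) /= big_enum /=.
rewrite (sum_half_ord (fun c i =>
  if b == c then 'X_i ^+ k else (-1) ^+ k.-1 * 'X_i ^+ k : {mpoly rat[N]})).
rewrite /super_psum /psum scaler_sumr; apply: eq_bigr => i _.
by rewrite scalerDl scale1r -signr_odd -[in RHS]signr_odd scaler_sign mulr_sign; case: b => //=; rewrite addrC.
Qed.

Lemma enum_letters_sorted : sorted (fun u v : 'I_(2 * N) => u < v)%N (enum 'I_(2 * N)).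
Proof.
have := iota_ltn_sorted 0 (2 * N); rewrite -val_enum_ord.
by rewrite sorted_map.
Qed.

Lemma rises_true (y z : 'I_(2 * N)) :
  (rises y z == true) = (y < z)%N || (true == odd y) && (y == z).
Proof. by rewrite /rises eqb_id; case: (odd y). Qed.

(** Negating [rises] reverses the order and exchanges the repeatable kind of letter, so columns are
    chains in the reversed alphabet. *)
Lemma rises_false (y z : 'I_(2 * N)) :
  (rises y z == false) = (z < y)%N || (false == odd y) && (y == z).
Proof. by rewrite /rises -val_eqE /=; case: (odd y); case: ltngtP. Qed.

Lemma ribbon_poly_true n :
  ribbon_poly N (nseq n true) =
  chain_sum [seq ('X_(half_ord y) : {mpoly rat[N]}, true == odd y) | y <- enum 'I_(2 * N)] n.+1.
Proof.
apply: (@word_sum_nseq _ _ _ _ _ (fun u v : 'I_(2 * N) => u < v)%N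
  (fun y : 'I_(2 * N) => true == odd y) _ _ _ _ _ _ rises_true).
- by move=> v u w; apply: ltn_trans.
- by move=> v; apply: ltnn.
- exact: enum_letters_sorted.
- by move=> v; rewrite mem_enum.
Qed.

Lemma ribbon_poly_false n :
  ribbon_poly N (nseq n false) =
  chain_sum [seq ('X_(half_ord y) : {mpoly rat[N]}, false == odd y) | y <- rev (enum 'I_(2 * N))] n.+1.
Proof.
apply: (@word_sum_nseq _ _ _ _ _ (fun u v : 'I_(2 * N) => v < u)%N
  (fun y : 'I_(2 * N) => false == odd y) _ _ _ _ _ _ rises_false).
- by move=> v u w vu wv; apply: ltn_trans wv vu.
- by move=> v; apply: ltnn.
- by rewrite rev_sorted enum_letters_sorted.
- by move=> v; rewrite mem_rev mem_enum.
Qed.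

Lemma newton_row_poly n :
  row_poly N n *+ n = \sum_(k < n) super_psum N k.+1 * row_poly N (n.-1 - k).
Proof.
set s := [seq ('X_(half_ord y) : {mpoly rat[N]}, true == odd y) | y <- enum 'I_(2 * N)].
have rowE m : row_poly N m = chain_sum s m.
  by case: m => [|m]; rewrite ?chain_sum0 // -ribbon_poly_true.
rewrite rowE newton_chain_sum; apply: eq_bigr => k _.
by rewrite rowE signed_psum_letters.
Qed.

Lemma newton_unique (c c' P : nat -> {mpoly rat[N]}) :
  c 0 = c' 0 ->
  (forall n, c n *+ n = \sum_(k < n) P k.+1 * c (n.-1 - k)%N) ->
  (forall n, c' n *+ n = \sum_(k < n) P k.+1 * c' (n.-1 - k)%N) ->
  c =1 c'.
Proof.
move=> cc' cP c'P n; elim/ltn_ind: n => -[|n] IHn //.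
apply: (@mulrSn_inj _ n); rewrite /= cP c'P; apply: eq_bigr => k _.
by rewrite IHn // ltnS leq_subr.
Qed.

(** Rows and columns satisfy Newton's recurrence with the same power sums, and the recurrence has
    one solution over the rationals. *)
Lemma ribbon_poly_nseq n : ribbon_poly N (nseq n false) = ribbon_poly N (nseq n true).
Proof.
rewrite ribbon_poly_true ribbon_poly_false.
apply: (newton_unique (P := super_psum N)); first by rewrite !chain_sum0.
- move=> m; rewrite newton_chain_sum; apply: eq_bigr => k _.
  by rewrite signed_psum_letters // perm_rev.
- move=> m; rewrite newton_chain_sum; apply: eq_bigr => k _.
  by rewrite signed_psum_letters.
Qed.

(** Negation swaps the two summands of the concatenation rule, and rows and columns agree. Combined
    with the reversal below it gives transposition; reversal alone is rotation. *)
Lemma ribbon_poly_negb p : ribbon_poly N (map negb p) = ribbon_poly N p.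
Proof.
apply: (@word_sum_eq_of_trueseq _ (fun p => ribbon_poly N (map negb p))) p.
- by move=> p q; rewrite ribbon_polyM !map_cat /= addrC.
- exact: ribbon_polyM.
- by move=> n; rewrite map_nseq ribbon_poly_nseq.
Qed.

Lemma ribbon_poly_rev p : ribbon_poly N (rev p) = ribbon_poly N p.
Proof.
apply: (@word_sum_eq_of_trueseq _ (fun p => ribbon_poly N (rev p))) p.
- by move=> p q; rewrite mulrC ribbon_polyM !rev_cat !rev_cons !cat_rcons.
- exact: ribbon_polyM.
- by move=> n; rewrite rev_nseq.
Qed.

(* Transposition exchanges the two concatenations of a ribbon with its
   transpose, so each is half of the square. *)
Lemma ribbon_poly_double p b :
  ribbon_poly N (rev (map negb p) ++ b :: p) = 2^-1 *: ribbon_poly N p ^+ 2.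
Proof.
set q := rev (map negb p).
(* Reversing and negating [q ++ b :: p] fixes the two outer parts and flips only [b]. *)
have qp_sym : ribbon_poly N (q ++ true :: p) = ribbon_poly N (q ++ false :: p).
  rewrite -ribbon_poly_rev -ribbon_poly_negb; congr ribbon_poly.
  rewrite rev_cat rev_cons map_cat map_rcons cat_rcons /q revK.
  by rewrite map_rev; congr (_ ++ _ :: _); rewrite mapK //; exact: negbK.
have : ribbon_poly N p ^+ 2 = ribbon_poly N (q ++ b :: p) *+ 2.
  rewrite expr2 -{1}(ribbon_poly_negb p) -(ribbon_poly_rev (map negb p)) -/q.
  by rewrite ribbon_polyM mulr2n; case: b; rewrite qp_sym.
by move->; rewrite -scaler_nat scalerA mulVf ?scale1r // pnatr_eq0.
Qed.

(** The ribbon is (1,1,n+1). Multiplying a row by a column of two boxes, then a longer row by one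
    box, produces it up to rows; the column of two boxes equals q_2. *)
Lemma ribbon_poly_hook n :
  ribbon_poly N (nseq n true ++ [:: false; false]) =
  row_poly N n.+3 - row_poly N 1 * row_poly N n.+2 + row_poly N 2 * row_poly N n.+1.
Proof.
have E1 := ribbon_polyM (nseq n true) [:: false].
have E2 := ribbon_polyM (nseq n.+1 true) [::].
have E3 m s : nseq m true ++ true :: s = nseq m.+1 true ++ s by elim: m => //= m ->.
rewrite !E3 ?cats0 in E1 E2.
rewrite /row_poly -(ribbon_poly_nseq 1) /= -/(nseq n.+1 true) -/(nseq n.+2 true).
rewrite -[ribbon_poly N [::] * _]mulrC E2.
rewrite -[ribbon_poly N [:: false] * _]mulrC E1; ring.
Qed.

End RibbonPoly.

(** * Positivity in power sums *)

(** A single list [s] serves every number of variables, so the family represents one symmetric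
    function. *)
Definition poly_ppositive n (F : forall N, {mpoly rat[N]}) : Prop :=
  exists s : seq (rat * seq nat),
    all (fun t => [&& (0 <= t.1)%R, all (ltn 0) t.2 & sumn t.2 == n]) s /\
    forall N, F N = (\sum_(t <- s) t.1 *: \prod_(k <- t.2) psum N k)%R.

Section PolyPpositive.
Local Open Scope ring_scope.

Lemma eq_poly_ppositive n (F G : forall N, {mpoly rat[N]}) :
  (forall N, F N = G N) -> poly_ppositive n F -> poly_ppositive n G.
Proof. by move=> FG [s [s_ok sF]]; exists s; split=> // N; rewrite -FG. Qed.

Lemma poly_ppositive0 n : poly_ppositive n (fun N => 0).
Proof. by exists [::]; split=> // N; rewrite big_nil. Qed.

Lemma poly_ppositive1 : poly_ppositive 0 (fun N => 1).
Proof.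
exists [:: (1, [::])]; split=> [//|N].
by rewrite big_seq1 big_nil scale1r.
Qed.

Lemma poly_ppositiveD n F G : poly_ppositive n F -> poly_ppositive n G ->
  poly_ppositive n (fun N => F N + G N).
Proof.
move=> [s [s_ok sF]] [t [t_ok tG]]; exists (s ++ t); split=> [|N].
  by rewrite all_cat s_ok.
by rewrite big_cat /= sF tG.
Qed.

Lemma poly_ppositive_sum n m (F : nat -> forall N, {mpoly rat[N]}) :
  (forall k, (k < m)%N -> poly_ppositive n (F k)) ->
  poly_ppositive n (fun N => \sum_(k < m) F k N).
Proof.
elim: m => [|m IHm] Fpos.
  by apply: eq_poly_ppositive (poly_ppositive0 n) => N; rewrite big_ord0.
have Fpos' k : (k < m)%N -> poly_ppositive n (F k) by move/ltnW; apply: Fpos.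
apply: eq_poly_ppositive (poly_ppositiveD (IHm Fpos') (Fpos m _)) => // N.
by rewrite big_ord_recr.
Qed.

Lemma poly_ppositiveZ n c F : 0 <= c -> poly_ppositive n F ->
  poly_ppositive n (fun N => c *: F N).
Proof.
move=> c_ge0 [s [s_ok sF]]; exists [seq (c * t.1, t.2) | t <- s]; split=> [|N].
  rewrite all_map; apply: sub_all s_ok => t /and3P[t_ge0 tpos tn] /=.
  by rewrite mulr_ge0 // tpos.
by rewrite sF big_map scaler_sumr; apply: eq_bigr => t _; rewrite scalerA.
Qed.

Lemma poly_ppositiveM n m F G : poly_ppositive n F -> poly_ppositive m G ->
  poly_ppositive (n + m)%N (fun N => F N * G N).
Proof.
move=> [s [s_ok sF]] [t [t_ok tG]].
exists [seq (u.1 * v.1, u.2 ++ v.2) | u <- s, v <- t]; split=> [|N].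
  apply/all_allpairsP => u v /(allP s_ok) /and3P[u0 upos /eqP un].
  move=> /(allP t_ok) /and3P[v0 vpos /eqP vn] /=.
  by rewrite mulr_ge0 // all_cat upos vpos sumn_cat un vn /=.
rewrite sF tG big_allpairs_dep mulr_suml; apply: eq_bigr => u _.
rewrite mulr_sumr; apply: eq_bigr => v _.
by rewrite big_cat /= -scalerAl -scalerAr scalerA.
Qed.

Lemma poly_ppositive_psum k : (0 < k)%N -> poly_ppositive k (fun N => psum N k).
Proof.
move=> k_gt0; exists [:: (1, [:: k])]; split=> [|N].
  by rewrite /= k_gt0 addn0 eqxx.
by rewrite !big_seq1 scale1r.
Qed.

Lemma poly_ppositive_super k : (0 < k)%N -> poly_ppositive k (fun N => super_psum N k).
Proof.
move=> k_gt0; apply: poly_ppositiveZ (poly_ppositive_psum k_gt0).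
by rewrite -signr_odd; case: odd.
Qed.

Lemma poly_ppositive_newton n (F : forall N, {mpoly rat[N]}) G :
  poly_ppositive n.+1 G -> (forall N, F N *+ n.+1 = G N) -> poly_ppositive n.+1 F.
Proof.
move=> Gpos FG; have n_ge0 : 0 <= n.+1%:R^-1 :> rat by rewrite invr_ge0 ler0n.
apply: eq_poly_ppositive (poly_ppositiveZ n_ge0 Gpos) => N.
by rewrite -FG -scaler_nat scalerA mulVf ?scale1r // pnatr_eq0.
Qed.

Lemma poly_ppositive_row n : poly_ppositive n (fun N => row_poly N n).
Proof.
elim/ltn_ind: n => -[|n] IHn; first exact: poly_ppositive1.
apply: poly_ppositive_newton (fun N => newton_row_poly N n.+1).
apply: (poly_ppositive_sum (F := fun k N => super_psum N k.+1 * row_poly N (n - k))).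
(* The degree n+1 is split as (k+1) + (n-k) to match the two factors. *)
move=> k lt_k; rewrite -{1}(subnKC (lt_k : k <= n)%N) -addSn.
apply: (poly_ppositiveM (F := fun N => super_psum N k.+1) (G := fun N => row_poly N (n - k))).
  exact: poly_ppositive_super.
by apply: IHn; rewrite ltnS leq_subr.
Qed.

Lemma super_psum2 N : super_psum N 2 = 0.
Proof. by rewrite /super_psum /= expr1 subrr scale0r. Qed.

(* The coefficients of (1 - u + u^2/2) Q(t), where Q(t) = exp(u + ...) is the
   generating function of [row_poly] and u = 2 p_1 t; its logarithmic derivative
   has no negative terms because that of (1 - u + u^2/2) e^u is u^2/2 e^u. *)
Definition hook_poly N n : {mpoly rat[N]} :=
  match n with
  | 0 => 1
  | 1 | 2 => 0
  | n'.+3 => row_poly N n'.+3 - row_poly N 1 * row_poly N n'.+2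
             + row_poly N 2 * row_poly N n'.+1
  end.

(** Put H = (1 - u + u^2/2) Q and let S be the sum of [super_psum N k] t^k over k >= 3; the term k =
    2 vanishes. Then t H' = (u^3/2) Q + S H, because -u + u^2 + u (1 - u + u^2/2) = u^3/2, and u^3/2
    is [super_psum N 1 * row_poly N 2] times t^3. *)
Lemma newton_hook_poly N n :
  hook_poly N n.+3 *+ n.+3 =
  super_psum N 1 * row_poly N 2 * row_poly N n +
  \sum_(k < n.+1) super_psum N k.+3 * hook_poly N (n - k).
Proof.
set P := super_psum N; set q := row_poly N.
have q0 : q 0 = 1 by [].
have newton m : q m *+ m = \sum_(k < m) P k.+1 * q (m.-1 - k)%N := newton_row_poly N m.
have q1 : q 1 = P 1.
  by have := newton 1; rewrite mulr1n big_ord1 subnn q0 mulr1.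
have q2 : q 2 *+ 2 = P 1 * P 1.
  by rewrite newton !big_ord_recl big_ord0 /= /P super_psum2 mul0r !addr0 -/P -q1.
(* The coefficient of t^(m+2) in S Q. *)
pose t m := \sum_(k < m) P k.+3 * q (m.-1 - k)%N.
have newtonS m : q m.+1 *+ m.+1 = P 1 * q m + t m.-1.
  case: m => [|m]; first by rewrite q1 q0 /t big_ord0; ring.
  rewrite newton !big_ord_recl /= (_ : P _.+2 = 0) ?subn0; last exact: super_psum2.
  rewrite mul0r add0r.
  congr (_ + _); apply: eq_bigr => k _; rewrite /bump /= !add1n; congr (_ * q _); lia.
(* Shifts of [q] by one and two, zero at negative indices. With them one formula covers every
   [hook_poly]: the values at 1 and 2 vanish since 2 q_2 = q_1^2. *)
pose q1' m := if m is m'.+1 then q m' else 0.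
pose q2' m := if m is m'.+2 then q m' else 0.
have hookE m : hook_poly N m = q m - q 1 * q1' m + q 2 * q2' m.
  case: m => [|[|[|m]]] //=; first by rewrite ?q0; ring.
    by rewrite ?q0; ring.
  have -> : q 2 - q 1 * q 1 + q 2 * q 0 = q 2 *+ 2 - q 1 * q 1 by rewrite q0; ring.
  by rewrite q2 q1 subrr.
have -> : hook_poly N n.+3 = q n.+3 - q 1 * q n.+2 + q 2 * q n.+1 by [].
under eq_bigr => k _ do rewrite hookE mulrDr mulrBr !(mulrCA (P _)).
clearbody q.
rewrite big_split sumrB /= -!mulr_sumr.
have -> : \sum_(k < n.+1) P k.+3 * q1' (n - k)%N = t n.
  rewrite big_ord_recr /= subnn mulr0 addr0; apply: eq_bigr => k _.
  by have -> : (n - k = (n.-1 - k).+1)%N by have := ltn_ord k; lia.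
have -> : \sum_(k < n.+1) P k.+3 * q2' (n - k)%N = t n.-1.
  case: n => [|n]; first by rewrite big_ord1 /t big_ord0 mulr0.
  rewrite !big_ord_recr /= subnn subSnn /= !mulr0 !addr0; apply: eq_bigr => k _.
  by have -> : (n.+1 - k = (n.-1 - k).+2)%N by have := ltn_ord k; lia.
rewrite -[\sum_(k < n.+1) _]/(t n.+1).
(* The factor n+3 is split as (n+2) + 1 and (n+1) + 2, so that each q_m carries its own m and
   [newtonS] applies. *)
transitivity (q n.+3 *+ n.+3 - q 1 * (q n.+2 *+ n.+2) - q 1 * q n.+2
   + q 2 * (q n.+1 *+ n.+1) + q 2 *+ 2 * q n.+1); first by ring.
by rewrite q2 !newtonS q1 /=; ring.
Qed.

Lemma poly_ppositive_hook n : poly_ppositive n (fun N => hook_poly N n).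
Proof.
elim/ltn_ind: n => -[|[|[|n]]] IHn; first exact: poly_ppositive1.
- exact: poly_ppositive0.
- exact: poly_ppositive0.
apply: poly_ppositive_newton (fun N => newton_hook_poly N n).
apply: poly_ppositiveD.
  rewrite -[n.+3]/(1 + 2 + n)%N; apply: poly_ppositiveM (poly_ppositive_row n).
  by apply: poly_ppositiveM (poly_ppositive_row 2); apply: poly_ppositive_super.
apply: (poly_ppositive_sum (F := fun k N => super_psum N k.+3 * hook_poly N (n - k))).
move=> k lt_k; rewrite -{1}(subnKC (lt_k : k <= n)%N) -!addSn.
apply: (poly_ppositiveM (F := fun N => super_psum N k.+3) (G := fun N => hook_poly N (n - k))).
  exact: poly_ppositive_super.
by apply: IHn; rewrite !ltnS; apply: leq_trans (leq_subr _ _) _; do 2!apply: ltnW.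
Qed.

Lemma natr_card_set (T : finType) (P : pred T) :
  #|[set f | P f]|%:R = \sum_f (P f)%:R :> rat.
Proof. by rewrite -sum1dep_card natr_sum big_mkcond; apply: eq_bigr => f _; case: (P f). Qed.

(** Expanding the product selects one variable for each part, which is the function [g] counted by
    [pcoef]. *)
Lemma pcoefE lam N a :
  (pcoef lam N a)%:R = (\prod_(k <- lam) psum N k)@_[multinom a i | i < N].
Proof.
rewrite (big_nth 0%N) big_mkord /psum bigA_distr_bigA /= raddf_sum natr_card_set.
apply: eq_bigr => g _; rewrite mprodXnE /= mcoeffX; congr (nat_of_bool _)%:R.
have coordE i : (\sum_j U_(g j) *+ (nth 0 lam j)%N)%MM i = (\sum_(j | g j == i) nth 0 lam j)%N.
  rewrite mnm_sumE [RHS]big_mkcond; apply: eq_bigr => j _.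
  by rewrite mulmnE mnm1E; case: (g j == i); rewrite ?mul1n.
apply/forallP/eqP => [ga|Em i]; last by rewrite -coordE Em mnmE.
by apply/mnmP => i; rewrite mnmE coordE; apply/eqP/ga.
Qed.

(** A part v of multiplicity m satisfies m v <= n, so [inord] truncates no multiplicity and no part
    exceeds n. *)
Lemma perm_mparts n (lam : seq nat) :
  all (ltn 0) lam -> sumn lam = n ->
  perm_eq (mparts [ffun i : 'I_n => inord (count_mem i.+1 lam) : 'I_n.+1]) lam.
Proof.
move=> lam_pos lam_n.
have count_le v : (count_mem v lam * v <= n)%N.
  rewrite -lam_n {lam_pos lam_n}; elim: lam => //= k lam IHlam.
  by case: (k =P v) => [->|_] /=; lia.
have mem_le v : v \in lam -> (v <= n)%N.
  move=> v_lam; have v_gt0 : (0 < v)%N by apply: (allP lam_pos).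
  by have := count_le v; move: v_lam; rewrite -has_pred1 has_count; nia.
apply/allP => v _ /=; rewrite count_flatten -map_comp sumnE big_map big_enum /=.
apply/eqP; rewrite (eq_bigr (fun i : 'I_n => (i.+1 == v) * count_mem i.+1 lam)%N).
  case: v => [|v].
    rewrite big1 // ; apply/esym/count_memPn.
    by apply/negP => /(allP lam_pos).
  case: (ltnP v n) => [lt_v|le_n].
    rewrite (bigD1 (Ordinal lt_v)) //= eqxx mul1n big1 ?addn0 // => i.
    by rewrite -val_eqE /= eqSS => /negPf ->.
  rewrite big1 => [|i _]; last by rewrite eqSS; case: eqP => // Di; have := ltn_ord i; lia.
  by apply/esym/count_memPn/negP => /mem_le; lia.
move=> i _; rewrite ffunE inordK /=; first by rewrite count_nseq.
by rewrite ltnS (leq_trans _ (count_le i.+1)) // leq_pmulr.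
Qed.

Lemma poly_ppositive_p_positive n F (G : forall N, ('I_N -> nat) -> rat) :
  poly_ppositive n F ->
  (forall N a, G N a = (F N)@_[multinom a i | i < N]) -> p_positive n G.
Proof.
move=> [s [s_ok sF]] GF.
pose mult (lam : seq nat) : {ffun 'I_n -> 'I_n.+1} :=
  [ffun i : 'I_n => inord (count_mem i.+1 lam)].
(* Entries of [s] that list the same partition, possibly in different orders, are collected. *)
exists (fun m => \sum_(t <- s | mult t.2 == m) t.1); split=> [m|N a].
  rewrite big_seq_cond; apply: sumr_ge0 => t /andP[/(allP s_ok) /and3P[]//].
rewrite GF sF raddf_sum /=.
under [RHS]eq_bigr => m _ do rewrite big_mkcond mulr_suml.
rewrite exchange_big /= big_seq [RHS]big_seq; apply: eq_bigr => t t_s.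
have /and3P[_ t_pos /eqP t_n] := allP s_ok t t_s.
have t_perm := perm_mparts t_pos t_n; rewrite -/(mult t.2) in t_perm.
rewrite (bigD1 (mult t.2)) /=; last by rewrite (perm_sumn t_perm) t_n.
rewrite eqxx [X in _ + X]big1 ?addr0 => [|m /andP[_ /negPf]]; last first.
  by rewrite eq_sym => ->; rewrite mul0r.
by rewrite mcoeffZ pcoefE (perm_big _ t_perm).
Qed.

End PolyPpositive.

(** * Ribbons as lattice walks *)

(* Steps of the ribbon read from its bottom left to its top right box:
   [true] is a step to the right and [false] a step up. *)
Fixpoint pattern (al : seq nat) : seq bool :=
  if al is a :: al' then
    if nilp al' then nseq a.-1 true else pattern al' ++ false :: nseq a.-1 true
  else [::].

Definition walk_row (p : seq bool) i := count negb (drop i p).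
Definition walk_col (p : seq bool) i := count id (take i p).
Definition walk p := mkseq (fun i => (walk_row p i, walk_col p i)) (size p).+1.

Lemma walk_row_step p i : i < size p ->
  walk_row p i = ~~ nth true p i + walk_row p i.+1.
Proof. by move=> lt_i; rewrite /walk_row (drop_nth true lt_i). Qed.

Lemma walk_col_step p i : i < size p ->
  walk_col p i.+1 = walk_col p i + nth true p i.
Proof.
move=> lt_i; rewrite /walk_col (take_nth true lt_i) -cats1 count_cat /= addn0.
by [].
Qed.

Lemma walk_mono p i d : i + d <= size p ->
  [/\ walk_row p (i + d) <= walk_row p i, walk_col p i <= walk_col p (i + d)
    & walk_row p i + walk_col p (i + d) = walk_row p (i + d) + walk_col p i + d].
Proof.
elim: d => [|d IHd] le_id; first by rewrite !addn0.
rewrite addnS in le_id *; have [Hr Hc Hs] := IHd (ltnW le_id).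
have := walk_row_step le_id; have := walk_col_step le_id.
by case: (nth true p (i + d)) => /= -> Er; split; lia.
Qed.

Lemma walk_content p i : i <= size p -> walk_row p 0 + walk_col p i = walk_row p i + i.
Proof. by case/(@walk_mono p 0 i) => _ _; rewrite add0n [walk_col p 0]/walk_col take0 addn0. Qed.

Lemma nth_walk p i : i <= size p -> nth (0, 0) (walk p) i = (walk_row p i, walk_col p i).
Proof. by move=> le_i; rewrite nth_mkseq. Qed.

Lemma size_walk p : size (walk p) = (size p).+1.
Proof. by rewrite size_mkseq. Qed.

(** The second ribbon lies below the first, so its pattern is read first. *)
Lemma pattern_cat al be : ~~ nilp al -> ~~ nilp be ->
  pattern (al ++ be) = pattern be ++ false :: pattern al.
Proof.
move=> + be_n0; elim: al => // a al IHal _ /=.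
have -> : nilp (al ++ be) = false by rewrite /nilp size_cat addn_eq0 -[size be == 0]/(nilp be) (negPf be_n0) andbF.
case: (boolP (nilp al)) => [/nilP -> // | al_n0].
by rewrite IHal // -catA.
Qed.

Lemma pattern_near_cat al be :
  ~~ nilp al -> ~~ nilp be -> composition al -> composition be ->
  pattern (near_cat al be) = pattern be ++ true :: pattern al.
Proof.
case/lastP: al => // al a _; case: be => // b be _.
rewrite /near_cat /composition all_rcons size_rcons last_rcons -cats1 take_size_cat //= .
move=> /andP[a_gt0 _] /andP[b_gt0 _].
(* The merged row has (b-1) + 1 + (a-1) steps, the middle one being the junction. *)
have head_eq : pattern (a + b :: be) = pattern (b :: be) ++ true :: nseq a.-1 true.
  have -> : true :: nseq a.-1 true = nseq a true by case: a a_gt0.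
  rewrite /= (_ : (a + b).-1 = b.-1 + a); last by lia.
  by rewrite nseqD; case: ifP => _; rewrite // -catA.
rewrite -[if nilp be then _ else _]/(pattern (b :: be)).
case: (boolP (nilp al)) => [/nilP -> //|al_n0].
by rewrite !pattern_cat // head_eq -catA.
Qed.

Lemma size_pattern al : ~~ nilp al -> composition al -> (size (pattern al)).+1 = sumn al.
Proof.
elim: al => // a al IHal _ /= /andP[a_gt0 al_gt0].
case: (boolP (nilp al)) => [/nilP -> | al_n0] /=; rewrite ?size_cat /= size_nseq; first by lia.
by have := IHal al_n0 al_gt0; lia.
Qed.

Lemma start_cons a al r : start (a :: al) r.+1 = start al r.
Proof. by rewrite /start /= big_add1. Qed.

Lemma start0_pattern a al : ~~ nilp al -> start (a :: al) 0 = count id (pattern al).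
Proof.
rewrite /start /= big_add1 /=.
elim: al => // b al IHal _; rewrite big_ltn // big_add1 /=.
have count_row m : count id (nseq m true) = m by rewrite count_nseq mul1n.
case: (boolP (nilp al)) => [/nilP -> | al_n0].
  by rewrite big_geq // addn0 count_row.
by rewrite IHal // count_cat /= count_row add0n addnC.
Qed.

Lemma boxes_cons a al : boxes (a :: al) =
  [seq (0, c) | c <- iota (start (a :: al) 0) a] ++ [seq (b.1.+1, b.2) | b <- boxes al].
Proof.
rewrite /boxes /= map_flatten -map_comp (iotaDl 1 0) -map_comp.
congr (_ ++ flatten _); apply: eq_map => r /=.
by rewrite start_cons -map_comp.
Qed.

Lemma walk_cat_row p k : walk (p ++ false :: nseq k true) =
  [seq (b.1.+1, b.2) | b <- walk p] ++ [seq (0, c) | c <- iota (count id p) k.+1].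
Proof.
rewrite /walk /mkseq size_cat [size (_ :: _)]/= size_nseq -addSn iotaD map_cat -map_comp.
congr (_ ++ _).
  apply/eq_in_map => i; rewrite mem_iota add0n ltnS => /andP[_ le_i] /=.
  rewrite /walk_row /walk_col drop_cat take_cat.
  case: ltngtP le_i => // [lt_i | ->] _.
    by rewrite count_cat /= count_nseq /= addn1.
  by rewrite subnn drop_size take_size take0 cats0 /= count_nseq.
rewrite add0n -[(size p).+1]addn0 iotaDl -[count id p]addn0 iotaDl -!map_comp.
apply/eq_in_map => j; rewrite mem_iota ltnS => /andP[_ le_j] /=.
rewrite /walk_row /walk_col drop_cat take_cat addSn ltnNge ltnW ?ltnS ?leq_addr //=.
rewrite subSn ?leq_addr // addnC addnK /= drop_nseq take_nseq // count_nseq mul0n.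
by rewrite count_cat /= count_nseq mul1n add0n addnC.
Qed.

(** Only a permutation: [boxes] lists the rows from the top, the walk from the bottom. *)
Lemma perm_boxes_walk al : ~~ nilp al -> composition al ->
  perm_eq (boxes al) (walk (pattern al)).
Proof.
elim: al => // a al IHal _ /= /andP[a_gt0 al_gt0]; rewrite boxes_cons.
case: (boolP (nilp al)) => [/nilP -> | al_n0].
  rewrite cats0 /start big_geq // /walk /mkseq size_nseq prednK //.
  rewrite (eq_in_map (fun i => (walk_row _ i, _)) (fun c => (0, c)) _).1 // => i.
  rewrite mem_iota add0n => /andP[_ lt_i]; rewrite /walk_row /walk_col.
  by rewrite drop_nseq take_nseq ?count_nseq ?mul1n //; lia.
rewrite walk_cat_row prednK // start0_pattern // perm_catC perm_cat2r.
exact/perm_map/IHal.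
Qed.

(** * Fillings and symmetries of ribbons *)

(** The test of [valid_filling] with distinct boxes in place of distinct indices, so that it no
    longer refers to a listing of the boxes. *)
Definition box_ok (N : nat) (b b' : nat * nat) (v v' : 'I_(2 * N)) : bool :=
  [&& ((b.1 == b'.1) && (b.2 < b'.2)) ==> (v <= v'),
      ((b.2 == b'.2) && (b.1 < b'.1)) ==> (v <= v'),
      [&& b != b', b.2 == b'.2 & v == v'] ==> ~~ odd v
    & [&& b != b', b.1 == b'.1 & v == v'] ==> odd v].

Lemma risesE N (v v' : 'I_(2 * N)) :
  rises v v' = (v <= v') && ((v == v') ==> odd v).
Proof. by rewrite /rises -val_eqE /=; case: ltngtP => //; rewrite ?andbF ?andbT. Qed.

Lemma box_ok_row N (b b' : nat * nat) (v v' : 'I_(2 * N)) :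
  b.1 = b'.1 -> b.2 < b'.2 ->
  box_ok b b' v v' = rises v v' /\ (rises v v' -> box_ok b' b v' v).
Proof.
case: b b' => [r c] [r' c'] /= <- lt_c.
have [ncc' ncc] : (c == c') = false /\ (c' == c) = false by split; lia.
have lt_c' : (c' < c) = false by lia.
rewrite /box_ok risesE !xpair_eqE /= !eqxx !ltnn lt_c lt_c' ncc ncc' ?andbF /=.
by split=> // /andP[_]; rewrite [v' == v]eq_sym; case: eqP => // ->.
Qed.

Lemma box_ok_col N (b b' : nat * nat) (v v' : 'I_(2 * N)) :
  b.2 = b'.2 -> b'.1 < b.1 ->
  (~~ rises v v' -> box_ok b b' v v') /\ box_ok b' b v' v = ~~ rises v v'.
Proof.
case: b b' => [r c] [r' c'] /= <- lt_r.
have [nrr' nrr] : (r == r') = false /\ (r' == r) = false by split; lia.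
have lt_r' : (r < r') = false by lia.
have risesN : ~~ rises v v' = (v' <= v) && ((v == v') ==> ~~ odd v).
  by rewrite /rises -val_eqE /=; case: ltngtP => //; rewrite ?andbF ?andbT.
rewrite /box_ok risesN !xpair_eqE /= !eqxx !ltnn lt_r lt_r' nrr nrr' ?andbF /= ?andbT.
split; first by case/andP.
by rewrite [v' == v]eq_sym; case: eqP => // ->.
Qed.

Lemma box_ok_other N (b b' : nat * nat) (v v' : 'I_(2 * N)) :
  b.1 != b'.1 -> b.2 != b'.2 -> box_ok b b' v v'.
Proof. by rewrite /box_ok => /negPf -> /negPf ->; rewrite !andbF. Qed.

Lemma box_okxx N (b : nat * nat) (v : 'I_(2 * N)) : box_ok b b v v.
Proof. by rewrite /box_ok !eqxx !ltnn. Qed.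

Definition filling_ok n N (b : 'I_n -> nat * nat) (T : {ffun 'I_n -> 'I_(2 * N)}) :=
  [forall j, forall j', box_ok (b j) (b j') (T j) (T j')].

Lemma valid_fillingE bs N (T : {ffun 'I_(size bs) -> 'I_(2 * N)}) : uniq bs ->
  valid_filling T = filling_ok (fun j : 'I_(size bs) => nth (0, 0) bs j) T.
Proof.
move=> Ubs; apply: eq_forallb => j; apply: eq_forallb => j'.
by rewrite /box_ok (nth_uniq _ (ltn_ord j) (ltn_ord j') Ubs).
Qed.

(** Transitivity of [rises] and of its negation reduces the conditions on a whole row or column to
    consecutive boxes. *)
Lemma rises_trans N : transitive (@rises N).
Proof. by move=> v u w; rewrite /rises -!val_eqE /=; lia. Qed.

Lemma not_rises_trans N (u v w : 'I_(2 * N)) : ~~ rises u v -> ~~ rises v w -> ~~ rises u w.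
Proof. by rewrite /rises -!val_eqE /=; lia. Qed.

(** By monotonicity of the walk, two boxes in one row are joined by right steps only, and two in one
    column by up steps only. *)
Lemma walk_rises N p (t : nat -> 'I_(2 * N)) i d :
  (forall i, i < size p -> rises (t i) (t i.+1) = nth true p i) ->
  i + d.+1 <= size p ->
  (walk_row p i = walk_row p (i + d.+1) -> rises (t i) (t (i + d.+1))) /\
  (walk_col p i = walk_col p (i + d.+1) -> ~~ rises (t i) (t (i + d.+1))).
Proof.
move=> tP; elim: d => [|d IHd] le_id.
  rewrite addn1 in le_id *; rewrite tP // walk_col_step // walk_row_step //.
  by case: (nth true p i) => /=; split; lia.
rewrite addnS in le_id *; have [IHr IHc] := IHd (ltnW le_id).
have [Mr Mc _] := walk_mono (ltnW le_id).
have := tP _ le_id; have := walk_row_step le_id; have := walk_col_step le_id.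
case: (nth true p _) => /= Ec Er Et; split=> E; try by exfalso; lia.
  by apply: rises_trans Et; apply: IHr; lia.
by apply: not_rises_trans (negbT Et); apply: IHc; lia.
Qed.

Lemma filling_ok_walk N p (T : {ffun 'I_(size p).+1 -> 'I_(2 * N)}) :
  filling_ok (fun j : 'I_(size p).+1 => nth (0, 0) (walk p) j) T =
  [forall i : 'I_(size p), rises (T (inord i)) (T (inord i.+1)) == nth true p i].
Proof.
apply/idP/forallP => [/forallP okT [i lt_i] | okT].
  have Ei : inord i = i :> nat := @inordK (size p) i (ltnW lt_i).
  have Ei1 : inord i.+1 = i.+1 :> nat := @inordK (size p) i.+1 lt_i.
  have := forallP (okT (inord i)) (inord i.+1).
  have := forallP (okT (inord i.+1)) (inord i).
  have le_i := ltnW lt_i.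
  rewrite Ei Ei1 !nth_walk //=.
  have := walk_col_step lt_i; have := walk_row_step lt_i.
  case: (nth true p i) => /= Er Ec.
    by move=> _; rewrite (box_ok_row _ _ _ _).1 /= => [->|//|]; lia.
  by rewrite (box_ok_col _ _ _ _).2 /= => [/negPf->||]; lia.
pose t k := T (inord k).
have tP i : i < size p -> rises (t i) (t i.+1) = nth true p i.
  by move=> lt_i; apply/eqP/(okT (Ordinal lt_i)).
have TE (j : 'I_(size p).+1) : T j = t j by rewrite /t inord_val.
apply/forallP => j; apply/forallP => j'.
have lt_j := ltn_ord j; have lt_j' := ltn_ord j'; rewrite !ltnS in lt_j lt_j'.
rewrite (TE j) (TE j') !nth_walk //.
(* Two boxes of the walk share a row, share a column, or are unconstrained; both orders of the pair
   are tested. *)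
have main i i' : i < i' -> i' <= size p ->
    box_ok (walk_row p i, walk_col p i) (walk_row p i', walk_col p i') (t i) (t i') &&
    box_ok (walk_row p i', walk_col p i') (walk_row p i, walk_col p i) (t i') (t i).
  move=> lt_ii' le_i'; have Ei : i + (i' - i).-1.+1 = i' by lia.
  have le_i : i + (i' - i).-1.+1 <= size p by rewrite Ei.
  have := walk_rises tP le_i; have := walk_mono le_i; rewrite Ei.
  move=> [Mr Mc Ms] [Hr Hc].
  case: (walk_row p i =P walk_row p i') => [Er | /eqP Nr].
    have lt_c : walk_col p i < walk_col p i' by lia.
    have [-> okr] := @box_ok_row _ (walk_row p i, walk_col p i) (walk_row p i', walk_col p i') (t i) (t i') Er lt_c.
    by rewrite okr Hr.
  case: (walk_col p i =P walk_col p i') => [Ec | /eqP Nc].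
    have lt_r : walk_row p i' < walk_row p i by lia.
    have [okc ->] := @box_ok_col _ (walk_row p i, walk_col p i) (walk_row p i', walk_col p i') (t i) (t i') Ec lt_r.
    by rewrite okc Hc.
  by rewrite !box_ok_other // eq_sym.
case: (ltngtP j j') => [lt_jj'|lt_jj'|->]; last exact: box_okxx.
  by case/andP: (main _ _ lt_jj' lt_j').
by case/andP: (main _ _ lt_jj' lt_j).
Qed.

Section Fillings.
Local Open Scope ring_scope.

Lemma sum_filling_reindex (A : comNzRingType) N (x : 'I_(2 * N) -> A) m n
    (b : 'I_m -> nat * nat) (c : 'I_n -> nat * nat) (h : 'I_m -> 'I_n) :
  bijective h -> (forall j, b j = c (h j)) ->
  \sum_(T | filling_ok b T) \prod_j x (T j) = \sum_(T | filling_ok c T) \prod_j x (T j).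
Proof.
move=> [g hK gK] bE.
pose H (T : {ffun 'I_n -> 'I_(2 * N)}) : {ffun 'I_m -> 'I_(2 * N)} := [ffun j => T (h j)].
rewrite (reindex H); last first.
  exists (fun T : {ffun 'I_m -> 'I_(2 * N)} => [ffun i => T (g i)]) => T _;
  by apply/ffunP => i; rewrite !ffunE ?gK ?hK.
apply: eq_big => [T | T _]; last first.
  rewrite (reindex h); last by exists g => i _.
  by apply: eq_bigr => j _; rewrite ffunE.
apply/forallP/forallP => okT j; apply/forallP => j'.
  by have /forallP/(_ (g j')) := okT (g j); rewrite !ffunE !bE !gK.
by have /forallP/(_ (h j')) := okT (h j); rewrite !ffunE !bE.
Qed.

Lemma sum_filling_perm (A : comNzRingType) N (x : 'I_(2 * N) -> A) (bs cs : seq (nat * nat)) n :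
  uniq bs -> perm_eq bs cs -> size cs = n ->
  \sum_(T | filling_ok (fun j : 'I_(size bs) => nth (0%N, 0%N) bs j) T) \prod_j x (T j) =
  \sum_(T | filling_ok (fun j : 'I_n => nth (0%N, 0%N) cs j) T) \prod_j x (T j).
Proof.
move=> Ubs bs_cs <-; have Es := perm_size bs_cs.
have Ucs : uniq cs by rewrite -(perm_uniq bs_cs).
have lt_h (j : 'I_(size bs)) : (index (nth (0%N, 0%N) bs j) cs < size cs)%N.
  by rewrite index_mem -(perm_mem bs_cs) mem_nth.
have nth_h (j : 'I_(size bs)) :
    nth (0%N, 0%N) bs j = nth (0%N, 0%N) cs (index (nth (0%N, 0%N) bs j) cs).
  by rewrite nth_index // -index_mem.
apply: (@sum_filling_reindex _ _ _ _ _ _ _ (fun j => Ordinal (lt_h j))) => //.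
apply: inj_card_bij => [j j' [Ejj']|]; last by rewrite !card_ord Es.
apply/val_inj/eqP; rewrite -(nth_uniq (0%N, 0%N) (ltn_ord j) (ltn_ord j') Ubs).
by rewrite nth_h [X in _ == X]nth_h Ejj'.
Qed.

(** A box determines its content, and the content determines its index. *)
Lemma uniq_walk p : uniq (walk p).
Proof.
apply/mkseq_uniqP => i j; rewrite !inE !ltnS => le_i le_j [Er Ec].
by have := walk_content le_i; have := walk_content le_j; lia.
Qed.

(** The exponents of the monomial of a filling count the boxes carrying each index, so taking a
    coefficient selects the fillings counted by [rcoef]. *)
Lemma rcoefE D N a : ~~ nilp D -> composition D ->
  (rcoef D N a)%:R = (ribbon_poly N (pattern D))@_[multinom a i | i < N].
Proof.
move=> D_n0 D_gt0; have D_walk := perm_boxes_walk D_n0 D_gt0.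
have UD : uniq (boxes D) by rewrite (perm_uniq D_walk) uniq_walk.
rewrite /ribbon_poly word_sum_ffun.
under [in RHS]eq_bigl => T do rewrite -filling_ok_walk.
rewrite -(sum_filling_perm (fun v : 'I_(2 * N) => 'X_(half_ord v)) UD D_walk (size_walk _)).
rewrite natr_card_set raddf_sum /= [RHS]big_mkcond /=; apply: eq_bigr => T _.
rewrite valid_fillingE //; case: (filling_ok _ T) => //=.
rewrite mprodXE mcoeffX; congr (nat_of_bool _)%:R.
have coordE i : (\sum_j U_(half_ord (T j)))%MM i = #|[set j | ((T j)./2 == i)%N]|.
  rewrite mnm_sumE -sum1dep_card [RHS]big_mkcond; apply: eq_bigr => j _.
  by rewrite mnm1E -val_eqE /=; case: eqP.
apply/forallP/eqP => [Ta|Em i]; last by rewrite -coordE Em mnmE.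
by apply/mnmP => i; rewrite mnmE coordE; apply/eqP/Ta.
Qed.

End Fillings.

Section Symmetries.

Let intpt (b : nat * nat) : int * int := (Posz b.1, Posz b.2).

Lemma mem_boxesZ al : ~~ nilp al -> composition al ->
  boxesZ al =i [seq intpt b | b <- walk (pattern al)].
Proof. by move=> al_n0 al_gt0; apply/perm_mem/perm_map/perm_boxes_walk. Qed.

(* Along a ribbon the content (column minus row) increases by one at each step,
   so the set of boxes determines the walk. *)
Lemma pattern_unique al p (d : int * int) : composition al ->
  boxesZ al =i [seq (d.1 + Posz b.1, d.2 + Posz b.2)%R | b <- walk p] ->
  ~~ nilp al /\ pattern al = p.
Proof.
move=> al_gt0 al_p.
have al_n0 : ~~ nilp al.
  (* A walk has at least one box, even for the empty pattern. *)
  apply/negP => /nilP al0; have := al_p (d.1 + Posz (walk_row p 0), d.2 + Posz (walk_col p 0))%R.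
  rewrite al0 in_nil => /esym/negP; apply; apply/mapP.
  by exists (walk_row p 0, walk_col p 0) => //; rewrite -nth_walk // mem_nth ?size_walk.
split=> //; set q := pattern al.
(* Comparison by content: both lists are strictly sorted for it, so having the same elements makes
   them equal. *)
pose lt (b c : int * int) := (b.2 - b.1 < c.2 - c.1)%R.
have walk_sorted r (e : int * int) :
    sorted lt [seq (e.1 + Posz b.1, e.2 + Posz b.2)%R | b <- walk r].
  apply/(sortedP (0, 0)%R) => i; rewrite size_map size_walk ltnS => lt_i.
  have le_i := ltnW lt_i.
  rewrite !(nth_map (0, 0)) ?size_walk ?ltnS // !nth_walk // /lt /=.
  by have := walk_content lt_i; have := walk_content le_i; lia.
have E : [seq (0 + Posz b.1, 0 + Posz b.2)%R | b <- walk q] =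
         [seq (d.1 + Posz b.1, d.2 + Posz b.2)%R | b <- walk p].
  apply: (@irr_sorted_eq _ lt).
  - by move=> ? ? ?; apply: lt_trans.
  - by move=> ?; apply: ltxx.
  - exact: (walk_sorted q (0, 0)%R).
  - exact: walk_sorted.
  by move=> z; rewrite -al_p mem_boxesZ // (eq_map (g := intpt)).
have Es : size q = size p.
  by have := congr1 size E; rewrite !size_map !size_iota => -[].
have nthE i : i <= size p -> Posz (walk_col q i) = (d.2 + Posz (walk_col p i))%R.
  move=> le_i; have := congr1 (fun s => (nth (0, 0)%R s i).2) E.
  rewrite !(nth_map (0, 0)) ?size_walk ?ltnS ?Es //.
  by rewrite !nth_walk ?Es // add0r.
(* Both walks start in column 0, so there is no horizontal shift, and the steps can be read off the
   columns. *)
have d0 : d.2 = 0%R.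
  by have := nthE 0 isT; rewrite /walk_col !take0 addr0.
apply: (@eq_from_nth _ true) => // i; rewrite Es => lt_i.
have := nthE i (ltnW lt_i); have := nthE i.+1 lt_i; rewrite d0 !add0r => -[+] -[].
rewrite !walk_col_step ?Es //.
by case: (nth true q i); case: (nth true p i) => //=; lia.
Qed.

(** Reflection exchanges the two ends of the ribbon, so the walk is read backwards, and it exchanges
    right steps with up steps. *)
Lemma walk_transpose p :
  rev [seq (b.2, b.1) | b <- walk p] = walk (rev (map negb p)).
Proof.
apply: (@eq_from_nth _ (0, 0)) => [|i]; first by rewrite size_rev size_map !size_walk size_rev size_map.
rewrite size_rev size_map size_walk ltnS => le_i.
rewrite nth_rev ?size_map ?size_iota // subSS (nth_map (0, 0)) ?size_walk ?ltnS ?leq_subr //.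
rewrite !nth_walk ?size_rev ?size_map ?leq_subr // /walk_row /walk_col /=.
rewrite drop_rev take_rev size_map !count_rev -map_take -map_drop !count_map.
by congr (_, _); apply: eq_count => b /=; rewrite ?negbK.
Qed.

Lemma is_transpose_pattern al be :
  ~~ nilp al -> composition al -> composition be -> is_transpose al be ->
  ~~ nilp be /\ pattern be = rev (map negb (pattern al)).
Proof.
move=> al_n0 al_gt0 be_gt0 [d al_be]; apply: (@pattern_unique _ _ (d.1, d.2)) => // z.
rewrite al_be (eq_mem_map _ (mem_boxesZ al_n0 al_gt0)) -map_comp -walk_transpose.
rewrite map_rev mem_rev -map_comp; congr (z \in _); apply: eq_map => b /=.
by congr (_, _); rewrite addrC.
Qed.

Lemma is_rot_pattern al be :
  ~~ nilp al -> composition al -> composition be -> is_rot al be ->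
  ~~ nilp be /\ pattern be = rev (pattern al).
Proof.
move=> al_n0 al_gt0 be_gt0 [d al_be]; set p := pattern al.
(* Read backwards, a box in row r and column c becomes the box in row [count negb p] - r and column
   [count id p] - c; these totals correct the translation. *)
apply: (@pattern_unique _ _ (d.1 - Posz (count negb p), d.2 - Posz (count id p))%R) => // z.
rewrite al_be (eq_mem_map _ (mem_boxesZ al_n0 al_gt0)) -map_comp -/p -mem_rev.
congr (z \in _); apply: (@eq_from_nth _ (0, 0)%R).
  by rewrite size_rev !size_map !size_iota size_rev.
move=> i; rewrite size_rev size_map size_walk ltnS => le_i.
rewrite nth_rev ?size_map ?size_iota // subSS !(nth_map (0, 0)) ?size_walk ?ltnS ?leq_subr ?size_rev //.
rewrite !nth_walk ?size_rev ?leq_subr //= /walk_row /walk_col drop_rev take_rev !count_rev.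
have Er := count_cat negb (take (size p - i) p) (drop (size p - i) p).
have Ec := count_cat id (take (size p - i) p) (drop (size p - i) p).
rewrite cat_take_drop in Er Ec.
by congr (_, _); lia.
Qed.

End Symmetries.

(** * Positivity of the basic blocks and its preservation under doubling *)

Definition pattern_ppositive p :=
  poly_ppositive (size p).+1 (fun N => ribbon_poly N p).

Lemma pattern_ppositive_rev p : pattern_ppositive p -> pattern_ppositive (rev p).
Proof.
rewrite /pattern_ppositive size_rev; apply: eq_poly_ppositive => N.
by rewrite ribbon_poly_rev.
Qed.

Lemma pattern_ppositive_negb p : pattern_ppositive p -> pattern_ppositive (map negb p).
Proof.
rewrite /pattern_ppositive size_map; apply: eq_poly_ppositive => N.
by rewrite ribbon_poly_negb.
Qed.

Lemma pattern_ppositive_double p b :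
  pattern_ppositive p -> pattern_ppositive (rev (map negb p) ++ b :: p).
Proof.
move=> p_pos; rewrite /pattern_ppositive size_cat size_rev size_map /= -addSn.
have half_ge0 : (0 <= 2^-1 :> rat)%R by rewrite invr_ge0 ler0n.
apply: eq_poly_ppositive (poly_ppositiveZ half_ge0 (poly_ppositiveM p_pos p_pos)) => N.
by rewrite ribbon_poly_double.
Qed.

Lemma pattern_ppositive_row n : pattern_ppositive (nseq n true).
Proof. by rewrite /pattern_ppositive size_nseq; apply: (poly_ppositive_row n.+1). Qed.

Lemma pattern_ppositive_hook n : pattern_ppositive (nseq n true ++ [:: false; false]).
Proof.
rewrite /pattern_ppositive size_cat size_nseq addn2.
by apply: eq_poly_ppositive (poly_ppositive_hook n.+3) => N; rewrite ribbon_poly_hook.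
Qed.

Lemma basic_block_ppositive n B : 0 < n -> basic_block n B ->
  [/\ composition B, ~~ nilp B & pattern_ppositive (pattern B)].
Proof.
move=> n_gt0 [B_gt0 B_tri].
suff [B_n0 B_pos] : ~~ nilp B /\ pattern_ppositive (pattern B) by [].
have tri1_gt0 : composition (tri n 1) by rewrite /= addn1.
have tri1_pos : pattern_ppositive (pattern (tri n 1)).
  by rewrite /=; apply: pattern_ppositive_row.
have tri3_gt0 : composition (tri n 3) by rewrite /= addn1.
(* The pattern of [tri n 3] consists of n - 3 right steps followed by two up steps. *)
have tri3_pos : pattern_ppositive (pattern (tri n 3)).
  by rewrite /= -catA addn1; apply: pattern_ppositive_hook.
have tri1_n0 : ~~ nilp (tri n 1) by [].
have tri3_n0 : ~~ nilp (tri n 3) by [].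
case: B_tri => [-> // | [tr | [n_gt2 [-> // | [tr | [rot | [T [T_gt0 [tr rot]]]]]]]]].
- have [B_n0 ->] := is_transpose_pattern tri1_n0 tri1_gt0 B_gt0 tr.
  by split=> //; apply/pattern_ppositive_rev/pattern_ppositive_negb.
- have [B_n0 ->] := is_transpose_pattern tri3_n0 tri3_gt0 B_gt0 tr.
  by split=> //; apply/pattern_ppositive_rev/pattern_ppositive_negb.
- have [B_n0 ->] := is_rot_pattern tri3_n0 tri3_gt0 B_gt0 rot.
  by split=> //; apply: pattern_ppositive_rev.
have [T_n0 T_pat] := is_transpose_pattern tri3_n0 tri3_gt0 T_gt0 tr.
have [B_n0 ->] := is_rot_pattern T_n0 T_gt0 B_gt0 rot.
(* The reversals from transposition and rotation cancel, leaving only the negation. *)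
by split=> //; rewrite T_pat revK; apply: pattern_ppositive_negb.
Qed.

Lemma composition_near_cat al be :
  composition al -> composition be -> ~~ nilp be ->
  composition (near_cat al be) /\ ~~ nilp (near_cat al be).
Proof.
case: be => // b be; rewrite /composition /near_cat /nilp size_cat addnS.
rewrite all_cat /= addn_gt0 => al_gt0 /andP[-> ->] _; rewrite orbT !andbT; split=> //.
by apply/allP => x /mem_take /(allP al_gt0).
Qed.

Theorem mainTheorem13 (n : nat) (B : seq nat) (k : nat) (D : nat -> seq nat) :
  0 < n -> basic_block n B -> 1 <= k -> D 0 = B ->
  (forall i, 1 <= i <= k ->
     exists T, composition T /\ is_transpose (D i.-1) T /\
       (D i = near_cat (D i.-1) T \/ D i = D i.-1 ++ T)) ->
  p_positive (sumn (D k)) (fun N a => ((rcoef (D k) N a)%:R : rat)).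
Proof.
move=> n_gt0 B_basic _ D0 D_step.
suff [Dk_gt0 Dk_n0 Dk_pos] :
    [/\ composition (D k), ~~ nilp (D k) & pattern_ppositive (pattern (D k))].
  rewrite -(size_pattern Dk_n0 Dk_gt0).
  by apply: poly_ppositive_p_positive Dk_pos _ => N a; apply: rcoefE.
(* The bound stays fixed while the index varies in the induction, because [D_step] holds only up to
   [k]. *)
have: k <= k by [].
elim: {1 3 4 5}k => [|i IHi] le_ik; first by rewrite D0; apply: basic_block_ppositive B_basic.
have [Di_gt0 Di_n0 Di_pos] := IHi (ltnW le_ik).
have [T [T_gt0 [tr Di1]]] := D_step i.+1 le_ik; rewrite /= in tr Di1.
have [T_n0 T_pat] := is_transpose_pattern Di_n0 Di_gt0 T_gt0 tr.
(* Either way the new pattern is that of the transpose, one junction step, then that of [D i]; only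
   the junction step differs. *)
case: Di1 => ->.
  have [c_gt0 c_n0] := composition_near_cat Di_gt0 T_gt0 T_n0.
  by split=> //; rewrite pattern_near_cat // T_pat; apply: pattern_ppositive_double.
split; last by rewrite pattern_cat // T_pat; apply: pattern_ppositive_double.
  by rewrite /composition all_cat; apply/andP.
by rewrite /nilp size_cat addn_eq0 negb_and Di_n0.
Qed.
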